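(* Let $\mathcal{R}=\{R_t : t\geq 2\}$ be the family of all rings. Then $\pi(\mathcal{R})=\frac{1}{2}$.
   Context: A $3$-graph is a $3$-uniform hypergraph (edges are sets of three distinct vertices). For an integer $t\geq 2$, the ring $R_t$ is the $3$-graph on $2t$ distinct vertices $x_0,y_0,x_1,y_1,\dots,x_{t-1},y_{t-1}$ whose edges are all the triples $\{x_i,y_i,x_{i+1}\}$ and $\{x_i,y_i,y_{i+1}\}$ for $0\leq i\leq t-1$, with indices taken modulo $t$. For a family $\mathcal{H}$ of $3$-graphs, $\mathrm{ex}(n,\mathcal{H})$ is the maximum number of edges in an $n$-vertex $3$-graph containing no member of $\mathcal{H}$ as a (not necessarily induced) subgraph, and the Turán density is $\pi(\mathcal{H})=\lim_{n\to\infty}\mathrm{ex}(n,\mathcal{H})/\binom{n}{3}$ (this limit exists). *)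

(* Defs.v *)
From mathcomp Require Import all_boot all_order all_algebra.
From mathcomp Require Import all_classical all_reals all_analysis.
Import numFieldNormedType.Exports.

Set Implicit Arguments.
Unset Strict Implicit.
Unset Printing Implicit Defensive.

Import Order.TTheory GRing.Theory Num.Theory.

Definition uniform3 (V : finType) (E : {set {set V}}) : bool :=
  [forall e in E, #|e| == 3].

Record threegraph := ThreeGraph {
  vertex : finType;
  edges : {set {set vertex}};
  edges_uniform3 : uniform3 edges }.

(* Not necessarily induced: edges must map to edges, non-edges are free. *)
Definition contains (G F : threegraph) : Prop :=
  exists f : vertex F -> vertex G,
    injective f /\ forall e, e \in edges F -> (f @: e)%SET \in edges G.

Definition graph_family := threegraph -> Prop.

Definition family_free (H : graph_family) (G : threegraph) : Prop :=
  forall F, H F -> ~ contains G F.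

(* The condition on [E] says that it is the edge set of an [H]-free 3-graph on
   the vertex set {0, ..., n-1}. *)
Definition ex (n : nat) (H : graph_family) : nat :=
  \max_(E : {set {set 'I_n}} |
      `[< exists E3 : uniform3 E, family_free H (ThreeGraph E3) >]) #|E|.

(* [lim] is total, with value 0 on divergent sequences in [R]; see
   [turan_density_neq0_cvg]. *)
Definition turan_density (R : realType) (H : graph_family) : R :=
  limn (fun n : nat => (ex n H)%:R / 'C(n, 3)%:R : R)%R.

Lemma turan_density_neq0_cvg (R : realType) (H : graph_family) :
  (turan_density R H != 0)%R ->
  cvgn (fun n : nat => (ex n H)%:R / 'C(n, 3)%:R : R)%R.
Proof.
by apply: contra_neqP => /dvgP.
Qed.

(* The vertices x_i and y_i are [(i, false)] and [(i, true)]; [ordS] is the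
   successor modulo [t]. *)
Definition ring_edges (t : nat) : {set {set 'I_t * bool}} :=
  [set [set (i, false); (i, true); (ordS i, b)] | i : 'I_t, b : bool]%SET.

Lemma ring_edges_uniform3 (t : nat) : 2 <= t -> uniform3 (ring_edges t).
Proof.
move=> t2; apply/forall_inP => _ /imset2P[i b _ _ ->].
have neq : ordS i != i.
  rewrite -val_eqE /=; case: i => i it /=.
  have [i1t|] := ltnP i.+1 t; first by rewrite modn_small // gtn_eqF.
  move=> ti; have -> : i.+1 = t by apply/eqP; rewrite eqn_leq it ti.
  by rewrite modnn; case: i it ti => // _ /(leq_trans t2).
rewrite finset.setUC cardsU1 cards2 !inE !xpair_eqE (negbTE neq) /=.
by rewrite eqxx.
Qed.

Definition ring_graph (t : nat) (t2 : 2 <= t) : threegraph :=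
  ThreeGraph (ring_edges_uniform3 t2).

Definition rings : graph_family :=
  fun F => exists (t : nat) (t2 : 2 <= t), F = ring_graph t2.

(* Main.v *)
Require Import Defs.
From mathcomp Require Import all_boot all_order all_algebra.
From mathcomp Require Import all_classical all_reals all_analysis.
From mathcomp Require Import zify lra.
Import Order.TTheory GRing.Theory Num.Theory.
Import numFieldNormedType.Exports.

(** Say that a pair P of vertices points to a pair Q when P together with
    either vertex of Q is an edge.  A ring is exactly a directed cycle of
    pairwise disjoint pairs for this relation.

    Lower bound.  On {0, ..., n-1} take the triples whose two larger vertices
    have opposite parity ([parity_edges]).  A pair of vertices of equal parity
    points only to pairs of the opposite common parity, and never to a pair
    containing a vertex below both of its own.  In a ring, the pair holding
    the smallest vertex v points to a pair of constant parity, hence so are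
    all the pairs that follow; but the pair just before v would have to point
    below itself ([parity_edges_no_ring]).  Lowering the largest vertex by one
    injects the triples left out into those kept, so at least half of all
    triples are edges ([leq_bin3_double_parity_edges]).

    Upper bound.  A pair {x, y} is pointed to by exactly the pairs lying in
    both the link of x and the link of y.  If every vertex of a set W of w
    vertices has a link of density at least 1/2 + eps, two links share a
    fraction 2 eps of all pairs, so every pair is pointed to by such a
    fraction.  Sample k pairs at random, k large in terms of eps and w large
    in terms of k: with positive probability the pairs are disjoint and each
    is pointed to by another one of the sample.  Following pointers backwards
    inside the sample closes a directed cycle, that is a ring.  So in a
    ring-free 3-graph every large vertex set has a vertex of degree less than
    (1/2 + eps) w^2 / 2 inside it ([exists_low_link]); deleting such vertices
    one by one bounds the number of edges by
    (1/2 + eps) n^3 / 6 + O(n^2) ([card_ring_free_le]). *)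

Set Implicit Arguments.
Unset Strict Implicit.
Unset Printing Implicit Defensive.

Local Open Scope set_scope.

(** * Rings as directed cycles of pairs *)

Definition has_ring (V : finType) (E : {set {set V}}) : Prop :=
  exists t, 2 <= t /\ exists f : 'I_t * bool -> V,
    injective f /\ forall e, e \in ring_edges t -> f @: e \in E.

Lemma family_free_ringsP (V : finType) (E : {set {set V}})
    (E3 : uniform3 E) :
  family_free rings (ThreeGraph E3) <-> ~ has_ring E.
Proof.
split=> [free [t [t2 ring]]|noring F [t [t2 ->]] ring]; last first.
  by apply: noring; exists t.
by apply: (free (ring_graph t2)) => //; exists t, t2.
Qed.

(** The pairs are ordered and may be degenerate: samples are then plain
    functions, and degenerate pairs are excluded by injectivity. *)
Definition points (V : finType) (E : {set {set V}}) (P Q : V * V) : bool :=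
  ([set P.1; P.2; Q.1] \in E) && ([set P.1; P.2; Q.2] \in E).

Lemma points_irrefl (V : finType) (E : {set {set V}}) (P : V * V) :
  uniform3 E -> points E P P = false.
Proof.
move=> /forall_inP E3; apply/negP => /andP[/E3 + _].
rewrite [in X in X -> _]finset.setUC finset.setUA finset.setUid cards2.
by case: (P.1 == P.2).
Qed.

(** A shortest period among all points, rather than the period of a chosen
    point, makes the iterates distinct at once: a coincidence between two of
    them would be a shorter period. *)
Lemma exists_cycle_of_pred (T : finType) (p : T -> T) (x0 : T) :
  exists (t : nat) (y : T),
    [/\ 0 < t, iter t p y = y &
        {in gtn t &, injective (fun i => iter i p y)}].
Proof.
have ex_period : exists t, (0 < t) && [exists y, iter t p y == y].
  have /trajectP[i ilt eqi] := looping_order p x0.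
  exists (order p x0 - i); rewrite subn_gt0 ilt; apply/existsP.
  by exists (iter i p x0); rewrite -iterD subnK ?eqi // ltnW.
have [t /andP[t0 /existsP[y /eqP yt]] tmin] := ex_minnP ex_period.
exists t, y; split=> // i j.
wlog ij : i j / i <= j => [sym|].
  by case: (leqP i j) => [/sym|/ltnW /sym h *]; [apply|symmetry; apply: h].
rewrite !inE => it jt eqij; apply/eqP; rewrite eqn_leq ij leqNgt.
apply/negP => ltij.
have := tmin (j - i); rewrite subn_gt0 ltij /=.
suff -> : [exists z, iter (j - i) p z == z] by lia.
by apply/existsP; exists (iter i p y); rewrite -iterD subnK // eqij.
Qed.

(** Choosing for each pair of the family one that points to it gives a
    self-map of the indices; a cycle of this map, read backwards, is a ring. *)
Lemma has_ring_of_dominated (V : finType) (E : {set {set V}}) (k : nat)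
    (g : 'I_k * bool -> V) :
  uniform3 E -> 0 < k -> injective g ->
  (forall j, exists i, points E (g (i, false), g (i, true))
                                (g (j, false), g (j, true))) ->
  has_ring E.
Proof.
move=> E3 k0 injg dom.
have [p pP] := choice dom.
have [t [y [t0 yt inj_it]]] := exists_cycle_of_pred p (Ordinal k0).
(* A cycle of length 1 would be a pair pointing to itself. *)
have t2 : 1 < t.
  case: t t0 yt {inj_it} => [|[|//]] // _ py.
  by have := pP y; rewrite [p y]py points_irrefl.
exists t; split=> //.
(* The map p sends a pair to one pointing to it, hence the reversed order;
   the equation yt closes the cycle from the last index back to 0. *)
pose P (i : 'I_t) := iter (t - i.+1) p y.
exists (fun x => g (P x.1, x.2)); split.
  move=> [i b] [j c] /injg [] /inj_it; rewrite !inE => eqP_ ->.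
  have [it jt] := (ltn_ord i, ltn_ord j).
  by congr (_, _); apply: ord_inj; move: eqP_; lia.
have PS i : p (P (ordS i)) = P i.
  rewrite /P -iterS /=; have [it|ti] := ltnP i.+1 t.
    by rewrite modn_small // -(_ : (t - i.+2).+1 = t - i.+1) //; lia.
  have -> : i.+1 = t by have := ltn_ord i; lia.
  by rewrite modnn subnn /= -iterS subn1 prednK.
move=> _ /imset2P[i b _ _ ->].
rewrite !imsetU !imset_set1 /=.
by have := pP (P (ordS i)); rewrite PS => /andP[] /=; case: b.
Qed.

(** * Sampling disjoint pairs *)

(** Edges are recorded as ordered pairs, so each one counts twice. *)
Definition link (V : finType) (E : {set {set V}}) (v : V) : {set V * V} :=
  [set P | [set P.1; P.2; v] \in E].

(** Once the pair of index j is fixed, each of the other k - 1 pairs has to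
    avoid the pairs pointing to it, which leaves at most M choices. *)
Lemma card_undominating_samples (V : finType) (E : {set {set V}})
    (W : {set V}) (k M : nat) (j : 'I_k) :
  (forall Q, Q \in finset.setX W W ->
    #|[set P in finset.setX W W | ~~ points E P Q]| <= M) ->
  #|[set g in ffun_on W : pred {ffun 'I_k * bool -> V} |
      [forall i, ~~ points E (g (i, false), g (i, true))
                             (g (j, false), g (j, true))]]|
    <= #|W| ^ 2 * M ^ k.-1.
Proof.
move=> undom; set B := finset _.
pose pairs (g : {ffun 'I_k * bool -> V}) :=
  [ffun i : 'I_k => (g (i, false), g (i, true))].
have pairs_inj : injective pairs.
  move=> g h /ffunP eq; apply/ffunP=> -[i b].
  by move: (eq i); rewrite !ffunE => -[]; case: b.
rewrite -(card_imset _ pairs_inj) -sum1_card.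
have BW h : h \in pairs @: B -> h j \in finset.setX W W.
  case/imsetP=> g; rewrite inE => /andP[/ffun_onP gW _] ->.
  by rewrite ffunE inE !gW.
rewrite (partition_big (fun h : {ffun _} => h j) (mem (finset.setX W W))) //=.
rewrite -[X in X ^ 2]/(#|W|) -mulnn -cardsX -sum_nat_const.
apply: leq_sum => Q QW.
(* The samples whose pair of index j is Q form part of a product. *)
pose F (i : 'I_k) : pred (V * V) := if i == j then pred1 Q else
  mem [set P in finset.setX W W | ~~ points E P Q].
rewrite sum1_card; apply: (@leq_trans #|family F|).
  apply: subset_leq_card; apply/fintype.subsetP => h /andP[].
  case/imsetP=> g; rewrite inE => /andP[/ffun_onP gW /forallP bad] -> /eqP hj.
  apply/familyP => i; rewrite /F; case: eqP => [->|_]; first exact/eqP.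
  by rewrite !inE !ffunE !gW /= -hj ffunE bad.
rewrite card_family foldrE big_image /= (bigD1 j) //= {1}/F eqxx card1 mul1n.
have -> : M ^ k.-1 = \prod_(i : 'I_k | i != j) M.
  by rewrite prod_nat_const cardC1 card_ord.
by apply: leq_prod => i /negbTE; rewrite /F => ->; exact: undom.
Qed.

(** The union bound: if there are more injective samples than samples in
    which some pair is undominated, an injective sample has all its pairs
    dominated by others of the sample.  Counting only injective samples makes
    the pairs disjoint without a separate estimate of collisions. *)
Lemma has_ring_of_sample_count (V : finType) (E : {set {set V}})
    (W : {set V}) (k M : nat) :
  uniform3 E -> 0 < k ->
  (forall Q, Q \in finset.setX W W ->
    #|[set P in finset.setX W W | ~~ points E P Q]| <= M) ->
  k * (#|W| ^ 2 * M ^ k.-1) < #|W| ^_ (k * 2) ->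
  has_ring E.
Proof.
move=> E3 k0 undom; apply: contraPP => noring; apply/negP; rewrite -leqNgt.
pose B (j : 'I_k) := [set g in ffun_on W : pred {ffun 'I_k * bool -> V} |
  [forall i, ~~ points E (g (i, false), g (i, true))
                         (g (j, false), g (j, true))]].
have -> : #|W| ^_ (k * 2) =
    #|[set g in ffun_on W : pred {ffun 'I_k * bool -> V} | injectiveb g]|.
  by rewrite card_inj_ffuns_on card_prod card_ord card_bool.
apply: (@leq_trans #|\bigcup_j B j|).
  apply: subset_leq_card; apply/fintype.subsetP => g.
  rewrite inE => /andP[gW /injectiveP ginj].
  apply: contra_notT noring => /bigcupP nB.
  apply: (has_ring_of_dominated E3 k0 ginj) => j.
  apply: contra_notP nB => nodom; exists j => //; rewrite inE gW /=.
  by apply/forallP => i; apply: contra_notN nodom => ?; exists i.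
apply: leq_trans (unstable.card_big_setU _ _ _) _.
rewrite -[X in X * (_ ^ _ * _)]card_ord -sum_nat_const; apply: leq_sum => j _.
exact: card_undominating_samples.
Qed.

(** * The size of the sample *)

(** Almost all maps from m points to w points are injective when w is much
    larger than m^2. *)
Lemma leq_expn_ffact (w m : nat) : w ^ m.+1 <= w * w ^_ m + m ^ 2 * w ^ m.
Proof.
elim: m => [|m IH]; first by rewrite ffactn0 expn1 muln1 leq_addr.
have ffact_le : w ^_ m <= w ^ m.
  elim: m {IH} => [|m IH]; first by rewrite ffactn0.
  by rewrite ffactnSr expnSr leq_mul // leq_subr.
have [wm|mw] := ltnP w m.
  apply: leq_trans (leq_addl _ _).
  rewrite expnS leq_mul2r; apply/orP; right.
  by move: wm; rewrite -mulnn; nia.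
rewrite ffactnSr !(expnS w) -!mulnn; move: IH ffact_le.
rewrite (expnS w) -?mulnn.
move: (w ^ m) (w ^_ m) => p f IH fp.
have fw : w * (f * w) = w * (f * m) + w * (f * (w - m)).
  by rewrite -!mulnDr subnKC.
have mfp : w * (f * m) <= w * (p * m) by rewrite leq_mul ?leq_mul.
have wIH : w * (w * p) <= w * (w * f + m * m * p) by rewrite leq_mul.
by lia.
Qed.

Lemma leq_expn_double_ffact (w m : nat) : 2 * m ^ 2 < w -> w ^ m <= 2 * w ^_ m.
Proof.
move=> mw; have := leq_expn_ffact w m; rewrite expnS => le.
have : 2 * m ^ 2 * w ^ m <= w * w ^ m by rewrite leq_mul2r ltnW ?orbT.
rewrite -(leq_pmul2l (_ : 0 < w)); last by lia.
move: le; set a := w ^ m; set b := w ^_ m; nia.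
Qed.

(** With q^m < 1/8, the value k = m^2 + 1 works, since q^(m^2) <= 1 / 8^m and
    (m^2 + 1) / 8^m <= 1/4. *)
Lemma exists_linear_times_geometric_lt_half (R : archiRealFieldType) (q : R) :
  (0 <= q < 1)%R ->
  exists k, 0 < k /\ (k%:R * q ^+ k.-1 < 1 / 2 :> R)%R.
Proof.
move=> /andP[q0 q1].
have [m qm] : exists m, (q ^+ m < 1 / 8 :> R)%R.
  have /cvgrPdist_lt/(_ (1 / 8)%R) :
      ((q ^+ n)%R @[n --> \oo] --> (0%R : R))%classic.
    by apply: cvg_expr; rewrite ger0_norm.
  case=> [|m _ /(_ m (leqnn _))]; first by lra.
  by rewrite sub0r normrN ger0_norm ?exprn_ge0 //; exists m.
exists (m ^ 2).+1; split=> //=; rewrite expnS expn1 exprM.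
have m0 : 0 < m by case: m qm => //; rewrite expr0; lra.
have : (4 * (m * m).+1 <= 8 ^ m)%N.
  elim: m m0 {qm} => [//|[//|m] IH] _.
  move: (IH isT); rewrite [8 ^ m.+2]expnS; move: (8 ^ m.+1) => u.
  by nia.
rewrite -(ler_nat R) natrM natrX => le4.
have qmm : (q ^+ m ^+ m <= (1 / 8) ^+ m :> R)%R.
  by apply: lerXn2r; rewrite ?nnegrE ?exprn_ge0 //; lra.
have e8 : (8 ^+ m * (1 / 8) ^+ m = 1 :> R)%R.
  by rewrite -exprMn mul1r divff ?expr1n // pnatr_eq0.
have p8 : (0 <= (1 / 8) ^+ m :> R)%R by rewrite exprn_ge0 //; lra.
have k0 : (0 <= (m * m).+1%:R :> R)%R by [].
have h1 := ler_wpM2l k0 qmm. have h2 := ler_wpM2r p8 le4.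
rewrite e8 in h2. lra.
Qed.

(** At most k q^(k-1) w^(2k) samples are bad when each pair misses at most
    q w^2 pairs, and at least w^(2k) / 2 samples are injective. *)
Lemma exists_sample_size (R : archiRealFieldType) (q : R) :
  (0 <= q < 1)%R ->
  exists k n0, 0 < k /\ forall w M, n0 <= w -> (M%:R <= q * w%:R ^+ 2)%R ->
    k * (w ^ 2 * M ^ k.-1) < w ^_ (k * 2).
Proof.
move=> q01; have [k [k0 kq]] := exists_linear_times_geometric_lt_half q01.
exists k, (2 * (k * 2) ^ 2).+1; split=> // w M wlarge Mq.
have /leq_expn_double_ffact le2 := wlarge.
have w0 : (0 < w%:R :> R)%R by rewrite ltr0n (leq_trans _ wlarge).
rewrite -(ltn_pmul2l (isT : 0 < 2)); apply: leq_trans le2.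
rewrite -(ltr_nat R) !natrM !natrX.
have q0 : (0 <= q)%R by case/andP: q01.
have MX : (M%:R ^+ k.-1 <= q ^+ k.-1 * w%:R ^+ (2 * k.-1) :> R)%R.
  rewrite exprM -exprMn lerXn2r // nnegrE //.
  by rewrite mulr_ge0 // exprn_ge0 // ltW.
have -> : (w%:R ^+ (k * 2) = w%:R ^+ 2 * w%:R ^+ (2 * k.-1) :> R)%R.
  by rewrite -exprD; congr (_ ^+ _)%R; lia.
have k0R : (0 <= 2 * k%:R * w%:R ^+ 2 :> R)%R.
  by rewrite !mulr_ge0 // ltW.
have h1 := ler_wpM2l k0R MX.
have W0 : (0 < w%:R ^+ 2 * w%:R ^+ (2 * k.-1) :> R)%R.
  by rewrite mulr_gt0 ?exprn_gt0.
have h2 : (2 * (k%:R * q ^+ k.-1) * (w%:R ^+ 2 * w%:R ^+ (2 * k.-1)) <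
           1 * (w%:R ^+ 2 * w%:R ^+ (2 * k.-1)) :> R)%R.
  by rewrite ltr_pM2r //; lra.
by move: h1 h2; rewrite mul1r; lra.
Qed.

(** * The upper bound *)

Lemma leq_double_degree_link (V : finType) (E : {set {set V}}) (v : V) :
  uniform3 E -> 2 * #|[set e in E | v \in e]| <= #|link E v|.
Proof.
move=> /forall_inP E3; pose deg := [set e in E | v \in e].
rewrite -[X in _ <= X]sum1_card.
rewrite (partition_big (fun P : V * V => [set P.1; P.2; v]) (mem deg)) /=;
  last by move=> P; rewrite !inE => ->; rewrite eqxx !orbT.
rewrite mulnC -sum_nat_const; apply: leq_sum => e.
rewrite inE => /andP[eE ve].
have /cards2P[a [b [ab eab]]] : #|e :\ v| == 2.
  by have := E3 e eE; rewrite (cardsD1 v) ve add1n eqSS.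
have eE' : [set a; b; v] = e by rewrite -eab finset.setUC finset.setD1K.
rewrite sum1_card -(_ : #|[set (a, b); (b, a)]| = 2); last first.
  by rewrite cards2 xpair_eqE (negbTE ab).
apply: subset_leq_card; apply/fintype.subsetP => P.
rewrite !inE => /orP[]/eqP->; rewrite unfold_in /= inE /=.
  by rewrite eE' eE eqxx.
by rewrite [[set b; a]]finset.setUC eE' eE eqxx.
Qed.

(** If all links had density at least 1/2 + eps in W, two of them would meet
    in a fraction 2 eps of the ordered pairs: by inclusion-exclusion, at most
    a fraction q = 1 - 2 eps of the pairs fails to point to a given pair. *)
Lemma exists_low_link (R : archiRealFieldType) (eps : R) :
  (0 < eps <= 1 / 2)%R ->
  exists n0, forall (V : finType) (E : {set {set V}}) (W : {set V}),
    uniform3 E -> {in E, forall e : {set V}, e \subset W} -> ~ has_ring E ->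
    n0 <= #|W| ->
    exists2 v, v \in W & (#|link E v|%:R < (1 / 2 + eps) * #|W|%:R ^+ 2 :> R)%R.
Proof.
move=> /andP[e0 e1]; have q01 : (0 <= 1 - 2 * eps < 1)%R by apply/andP; lra.
have [k [n0 [k0 sample]]] := exists_sample_size q01.
exists n0 => V E W E3 EW noring Wlarge.
apply: contrapT => nolow; apply: noring.
set q := (1 - 2 * eps)%R in q01 sample.
have qw0 : (0 <= q * #|W|%:R ^+ 2 :> R)%R.
  by case/andP: q01 => ? _; rewrite mulr_ge0 // exprn_ge0.
apply: (@has_ring_of_sample_count _ _ W k
  (Num.truncn (q * #|W|%:R ^+ 2)%R)) => //;
  last by apply: sample => //; rewrite truncn_le.
have high v : v \in W ->
    ((1 / 2 + eps) * #|W|%:R ^+ 2 <= #|link E v|%:R :> R)%R.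
  by move=> vW; rewrite leNgt; apply/negP => low; apply: nolow; exists v.
have linkW v : link E v \subset finset.setX W W.
  apply/fintype.subsetP => P; rewrite !inE => /EW /fintype.subsetP sub.
  by rewrite !sub // !inE eqxx ?orbT.
move=> [x y]; rewrite inE /= => /andP[xW yW].
rewrite truncn_ge_nat //.
have -> : [set P in finset.setX W W | ~~ points E P (x, y)] =
    finset.setX W W :\: (link E x :&: link E y).
  by apply/setP => P; rewrite !inE andbC.
have cU : #|link E x :|: link E y| <= #|W| ^ 2.
  by rewrite -mulnn -cardsX subset_leq_card // finset.subUset !linkW.
have cUI := cardsUI (link E x) (link E y).
have cI : #|link E x :&: link E y| <= #|W| ^ 2.
  rewrite -mulnn -cardsX subset_leq_card //.
  by rewrite (fintype.subset_trans (finset.subsetIl _ _)).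
have hx := high x xW. have hy := high y yW.
rewrite cardsD (finset.setIidPr _); last first.
  by rewrite (fintype.subset_trans (finset.subsetIl _ _)).
rewrite cardsX mulnn natrB // natrX.
move: cU cUI; rewrite -(ler_nat R) natrX => cU /(congr1 (fun n => n%:R : R)%R).
rewrite !natrD /q => cUI. lra.
Qed.

(** Delete low-degree vertices one at a time; deleting one from a set of w
    vertices loses at most (1/2 + eps) w^2 / 2 edges, which is at most the
    increment of (1/2 + eps) (w + 1)^3 / 6.  The constant K absorbs the sets
    too small for [exists_low_link]. *)
Lemma card_ring_free_le (R : archiRealFieldType) (eps : R) :
  (0 < eps <= 1 / 2)%R ->
  exists K, forall (V : finType) (E : {set {set V}}),
    uniform3 E -> ~ has_ring E ->
    (#|E|%:R <= K%:R + (1 / 2 + eps) * #|V|.+1%:R ^+ 3 / 6 :> R)%R.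
Proof.
move=> eps01; have [n0 low] := exists_low_link eps01.
have e0 : (0 < eps)%R by case/andP: eps01.
exists (2 ^ n0) => V E E3 noring.
suff bound (W : {set V}) : (#|[set e in E | e \subset W]|%:R <=
    (2 ^ n0)%:R + (1 / 2 + eps) * #|W|.+1%:R ^+ 3 / 6 :> R)%R.
  rewrite -cardsT; apply: le_trans (bound _); rewrite ler_nat.
  apply: subset_leq_card; apply/fintype.subsetP => e eE.
  by rewrite inE eE finset.subsetT.
move: {2}#|W| (erefl #|W|) => w; elim: w W => [|w IH] W cW.
all: set EW := finset _.
all: have [Wsmall|Wlarge] := leqP #|W| n0.
1,3: apply: ler_wpDr;
  [by rewrite !mulr_ge0 ?exprn_ge0 //; lra|rewrite ler_nat].
1,2: apply: (@leq_trans #|powerset W|);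
  [by apply: subset_leq_card; apply/fintype.subsetP => e;
      rewrite !inE => /andP[]|by rewrite card_powerset leq_pexp2l].
  by rewrite cW in Wlarge.
have EWW : {in EW, forall e : {set V}, e \subset W}.
  by move=> e; rewrite inE => /andP[].
have EW3 : uniform3 EW.
  apply/forall_inP => e; rewrite inE => /andP[+ _].
  by move/forall_inP: E3; apply.
have EWnoring : ~ has_ring EW.
  move=> [t [t2 [f [finj fE]]]]; apply: noring; exists t; split=> //.
  by exists f; split=> // e /fE; rewrite inE => /andP[].
have [v vW lowv] := low V EW W EW3 EWW EWnoring (ltnW Wlarge).
have degv := leq_double_degree_link v EW3.
have cWv : #|W :\ v| = w by have := cardsD1 v W; rewrite vW cW; lia.
have := IH _ cWv; set EWv := finset _ => boundv.
have split : #|EW| <= #|EWv| + #|[set e in EW | v \in e]|.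
  apply: leq_trans (leq_card_setU _ _); apply: subset_leq_card.
  apply/fintype.subsetP => e; rewrite !inE => /andP[-> eW] /=.
  rewrite eW finset.subsetD1 eW /=.
  by case: (v \in e).
move: degv split; rewrite -(ler_nat R) -[(_ <= _ + _)%N](ler_nat R) natrD natrM.
rewrite cWv in boundv; rewrite cW in lowv *.
move: boundv lowv.
rewrite -(natr1 w.+1) -(natr1 w); have : (0 <= w%:R :> R)%R by [].
move=> w_ge0; have : (0 <= (1 / 2 + eps) * (3 * w%:R + 4) :> R)%R.
  by apply: mulr_ge0; lra.
by lra.
Qed.

(** * The lower bound *)

Definition parity_triples (n : nat) : {set 3.-tuple 'I_n} :=
  [set t : 3.-tuple 'I_n | sorted ltn (map val t) &
    odd (tnth t (inord 1)) != odd (tnth t (inord 2))].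

Definition parity_edges (n : nat) : {set {set 'I_n}} :=
  [set [set x in t] | t : 3.-tuple 'I_n in parity_triples n].

Lemma parity_edgesP (n : nat) (e : {set 'I_n}) :
  reflect (exists a b c : 'I_n,
             [/\ e = [set a; b; c], a < b, b < c & odd b != odd c])
          (e \in parity_edges n).
Proof.
apply: (iffP imsetP) => [[t + ->]|[a [b [c [-> ab bc bcodd]]]]].
  case: t => -[|a [|b [|c [|]]]] // st; rewrite inE /= !(tnth_nth a) /=.
  rewrite !inordK //= andbT => /andP[/andP[ab bc] bcodd].
  exists a, b, c; split=> //; apply/setP=> x.
  by rewrite !inE -orbA.
exists [tuple a; b; c]; last by apply/setP=> x; rewrite !inE -orbA.
by rewrite inE /= !(tnth_nth a) /= !inordK //= ab bc.
Qed.

Lemma parity_edges_uniform3 (n : nat) : uniform3 (parity_edges n).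
Proof.
apply/forall_inP => _ /parity_edgesP[a [b [c [-> ab bc _]]]].
rewrite finset.setUC cardsU1 cards2 !inE -!val_eqE /=.
by rewrite (gtn_eqF (ltn_trans ab bc)) (gtn_eqF bc) (ltn_eqF ab).
Qed.

(** Unlike in [parity_edgesP], p and q come in any order: the vertices of a
    ring are not sorted, and only the smallest one of an edge can be told. *)
Lemma parity_edges_min (n : nat) (m p q : 'I_n) :
  [set m; p; q] \in parity_edges n -> m < p -> m < q -> odd q = ~~ odd p.
Proof.
move=> /parity_edgesP[a [b [c [e ab bc bcodd]]]] mp mq.
have am : a = m.
  apply: ord_inj; apply/eqP; rewrite eqn_leq; apply/andP; split.
    have : m \in [set a; b; c] by rewrite -e !inE eqxx.
    rewrite !inE => /orP[/orP[]|] /eqP -> //; first exact: ltnW.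
    exact: ltnW (ltn_trans ab bc).
  have : a \in [set m; p; q] by rewrite e !inE eqxx.
  by rewrite !inE => /orP[/orP[]|] /eqP -> //; apply: ltnW.
rewrite {}am in e ab; have mc := ltn_trans ab bc.
have larger x : x \in [set m; p; q] -> m < x -> x = b \/ x = c.
  rewrite e !inE => /orP[/orP[]|] /eqP ->; last by right.
    by rewrite ltnn.
  by left.
have [pE qE] : p \in [set m; p; q] /\ q \in [set m; p; q].
  by rewrite !inE !eqxx !orbT.
have [bE cE] : b \in [set m; p; q] /\ c \in [set m; p; q].
  by rewrite e !inE !eqxx !orbT.
case: (larger p pE mp) (larger q qE mq) => pbc [] qbc; move: bcodd bE cE.
- rewrite pbc qbc !inE => _ _ /orP[/orP[]|] /eqP cE.
  + by rewrite cE ltnn in mc.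
  + by rewrite cE ltnn in bc.
  + by rewrite cE ltnn in bc.
- by rewrite pbc qbc; case: (odd b) (odd c) => -[].
- by rewrite pbc qbc; case: (odd b) (odd c) => -[].
- rewrite pbc qbc !inE => _ /orP[/orP[]|] /eqP bE.
  + by rewrite bE ltnn in ab.
  + by rewrite bE ltnn in bc.
  + by rewrite bE ltnn in bc.
Qed.

Lemma val_iter_ordS (t s : nat) (i : 'I_t) :
  val (iter s (@ordS t) i) = (i + s) %% t.
Proof.
elim: s => [|s IH]; first by rewrite addn0 modn_small.
by rewrite iterS /= IH -addn1 modnDml addn1 addnS.
Qed.

(** Start from the pair P_0 containing the smallest vertex v of the ring: both
    vertices of the next pair differ in parity from the other vertex of P_0.
    Constant parity then propagates around the ring, up to the pair preceding
    v, and an edge formed by v and a larger pair of constant parity does not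
    exist. *)
Lemma parity_edges_no_ring (n : nat) : ~ has_ring (parity_edges n).
Proof.
move=> [t [t2 [f [finj fE]]]].
have edge i b :
    [set f (i, false); f (i, true); f (ordS i, b)] \in parity_edges n.
  have <- : f @: [set (i, false); (i, true); (ordS i, b)] =
      [set f (i, false); f (i, true); f (ordS i, b)].
    by rewrite !imsetU !imset_set1.
  by apply: fE; apply/imset2P; exists i b.
have fneq x y : x != y -> f x < f y \/ f y < f x.
  move=> xy; have : f x != f y by rewrite (inj_eq finj).
  by rewrite -val_eqE neq_ltn => /orP.
pose x0 : 'I_t * bool := (Ordinal (ltnW t2), false).
have [[i0 b0] _ v_min] := @arg_minnP _ x0 xpredT (fun x => val (f x)) isT.
have ordS_neq (i : 'I_t) : ordS i != i.
  apply/negP => /eqP eqi; have /forall_inP := parity_edges_uniform3 n.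
  move=> /(_ _ (edge i false)).
  rewrite eqi finset.setUC finset.setUA finset.setUid.
  by rewrite cards2; case: (_ != _).
have above_v x : x != (i0, b0) -> f (i0, b0) < f x.
  by move=> /fneq[|//]; rewrite ltnNge v_min.
pose mono i := odd (f (i, false)) = odd (f (i, true)).
(* Here v = f (i0, b0) and f (i0, ~~ b0) is the other vertex of P_0. *)
have mono_start : mono (ordS i0).
  have next b : odd (f (ordS i0, b)) = ~~ odd (f (i0, ~~ b0)).
    apply: (@parity_edges_min _ (f (i0, b0))).
    - by move: (edge i0 b); case: (b0);
        rewrite //= [[set f (i0, true); _]]finset.setUC.
    - by apply: above_v; rewrite xpair_eqE eqxx; case: (b0).
    - by apply: above_v; rewrite xpair_eqE (negbTE (ordS_neq _)).
  by rewrite /mono !next.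
have mono_next i : mono i -> mono (ordS i).
  move=> monoi.
  suff next b : odd (f (ordS i, b)) = ~~ odd (f (i, false)).
    by rewrite /mono !next.
  set r := f (ordS i, b).
  have ri c : f (i, c) < r \/ r < f (i, c).
    by apply: fneq; rewrite xpair_eqE eq_sym (negbTE (ordS_neq i)).
  have pq : f (i, false) < f (i, true) \/ f (i, true) < f (i, false).
    by apply: fneq; rewrite xpair_eqE eqxx.
  have min3 (x y z : 'I_n) :
      [set x; y; z] = [set f (i, false); f (i, true); r] ->
      x < y -> x < z -> odd z = ~~ odd y.
    by move=> eqxyz; apply: parity_edges_min; rewrite eqxyz edge.
  (* The new vertex r is not the smallest one of its edge, because the other
     two have equal parity; so the smallest one is in pair i, and r has the
     parity opposite to that of the other vertex of pair i. *)
  have m1 := min3 _ _ _ erefl.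
  have m2 : f (i, true) < f (i, false) -> f (i, true) < r ->
      odd r = ~~ odd (f (i, false)).
    by apply: min3; rewrite [[set f (i, true); _]]finset.setUC.
  have m3 : r < f (i, false) -> r < f (i, true) ->
      odd (f (i, true)) = ~~ odd (f (i, false)).
    by apply: min3; rewrite -finset.setUA finset.setUC.
  case: pq => [pq|qp].
    case: (ri false) => [pr|rp]; first by rewrite monoi; apply: m1.
    by have := m3 rp (ltn_trans rp pq); rewrite monoi; case: (odd _).
  case: (ri true) => [qr|rq]; first exact: m2.
  by have := m3 (ltn_trans rq qp) rq; rewrite monoi; case: (odd _).
have mono_all s : mono (iter s.+1 (@ordS t) i0).
  by elim: s => [//|s IH]; rewrite iterS; apply: mono_next.
pose i := iter t.-1 (@ordS t) i0.
have ordSi : ordS i = i0.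
  apply: val_inj; rewrite -[ordS i]/(iter t.-1.+1 (@ordS t) i0).
  rewrite prednK ?(ltnW t2) //.
  by rewrite val_iter_ordS modnDr modn_small.
have monoi : mono i by rewrite /i -[t.-1]prednK //; lia.
have := edge i b0; rewrite ordSi finset.setUC finset.setUA => /parity_edges_min.
have lt c : f (i0, b0) < f (i, c).
  apply: above_v; rewrite xpair_eqE -[X in _ == X]ordSi eq_sym.
  by rewrite (negbTE (ordS_neq i)).
by move=> /(_ (lt _) (lt _)); move: monoi; rewrite /mono => ->; case: (odd _).
Qed.

Lemma card_parity_edges (n : nat) : #|parity_edges n| = #|parity_triples n|.
Proof.
apply: card_in_imset => t u; rewrite !inE => /andP[st _] /andP[su _] /setP eqtu.
apply/val_inj/(inj_map val_inj)/(irr_sorted_eq ltn_trans ltnn) => // x.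
apply/mapP/mapP => -[y yt ->]; exists y => //.
all: by have := eqtu y; rewrite !inE yt.
Qed.

Definition ord_dec (n : nat) (i : 'I_n) : 'I_n :=
  Ordinal (leq_ltn_trans (leq_pred i) (ltn_ord i)).

(** Lowering the largest vertex c of a sorted triple (a, b, c) changes its
    parity; if b and c have equal parity, then c >= b + 2, so the result is
    again a sorted triple. *)
Lemma leq_bin3_double_parity_edges (n : nat) :
  'C(n, 3) <= 2 * #|parity_edges n|.
Proof.
rewrite card_parity_edges -card_ltn_sorted_tuples.
set S := finset _; pose D := parity_triples n.
have -> : S = D :|: (S :\: D).
  apply/setP=> t; rewrite !inE.
  by case: sorted; case: (odd _ != _).
apply: leq_trans (leq_card_setU _ _) _.
rewrite mul2n -addnn leq_add2l.
pose shift (t : 3.-tuple 'I_n) : 3.-tuple 'I_n :=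
  [tuple tnth t (inord 0); tnth t (inord 1); ord_dec (tnth t (inord 2))].
have shift_inj : {in S :\: D &, injective shift}.
  move=> [[|a [|b [|c [|]]]] // st] [[|a' [|b' [|c' [|]]]] // st'].
  rewrite !inE /= => /andP[_ /andP[ab /andP[bc _]]].
  move=> /andP[_ /andP[ab' /andP[bc' _]]].
  move=> /(congr1 val) /=; rewrite !(tnth_nth a) /= !inordK //= => -[-> -> cc'].
  apply: val_inj => /=; congr [:: _; _; _]; apply: val_inj => /=.
  by lia.
rewrite -(card_in_imset shift_inj); apply: subset_leq_card.
apply/fintype.subsetP => _ /imsetP[[[|a [|b [|c [|]]]] // st] + ->].
rewrite !inE /= !(tnth_nth a) /= !(tnth_nth a) /= !inordK //=.
by lia.
Qed.

(** * The density *)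

Lemma leq_ex_rings (n m : nat) :
  (forall E : {set {set 'I_n}}, uniform3 E -> ~ has_ring E -> #|E| <= m) ->
  ex n rings <= m.
Proof.
move=> bound; apply/bigmax_leqP => E /asboolP[E3 /family_free_ringsP].
exact: bound.
Qed.

Lemma ex_rings_ge (n : nat) (E : {set {set 'I_n}}) :
  uniform3 E -> ~ has_ring E -> #|E| <= ex n rings.
Proof.
move=> E3 noring.
apply: (@leq_bigmax_cond _ _ (fun E : {set {set 'I_n}} => #|E|)).
by apply/asboolP; exists E3; apply/family_free_ringsP.
Qed.

Lemma bin3_natr (R : archiRealFieldType) (n : nat) :
  ('C(n.+2, 3)%:R = n.+2%:R * n.+1%:R * n%:R / 6 :> R)%R.
Proof.
have bin6 : 'C(n.+2, 3) * 6 = n.+2 * n.+1 * n.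
  by rewrite -[6]/(3`!) bin_ffact !ffactnS ffactn0 muln1 mulnA.
by rewrite -!natrM -bin6 natrM mulfK.
Qed.

Lemma ex_rings_density_le (R : archiRealFieldType) (eps : R) :
  (0 < eps <= 1 / 4)%R ->
  exists N, forall n, N <= n ->
    ((ex n rings)%:R / 'C(n, 3)%:R <= 1 / 2 + 2 * eps :> R)%R.
Proof.
move=> /andP[e0 e1].
have [|K bound] := @card_ring_free_le R eps; first by apply/andP; lra.
pose N := Num.bound ((6 * K%:R + 50) / eps)%R.
exists N.+3 => -[|[|[|n]]] // Nn.
have nlarge : ((6 * K%:R + 50) <= eps * n.+1%:R :> R)%R.
  rewrite [(eps * _)%R]mulrC -ler_pdivrMr //.
  have /archi_boundP/ltW : (0 <= (6 * K%:R + 50) / eps :> R)%R.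
    by rewrite divr_ge0 ?(ltW e0) // addr_ge0 // mulr_ge0.
  by move/le_trans; apply; rewrite ler_nat -/N; lia.
rewrite ler_pdivrMr ?ltr0n ?bin_gt0 //.
have exle : ((ex n.+3 rings)%:R <=
    K%:R + (1 / 2 + eps) * n.+4%:R ^+ 3 / 6 :> R)%R.
  rewrite -truncn_ge_nat; last first.
    by rewrite addr_ge0 // divr_ge0 // mulr_ge0 ?exprn_ge0 //; lra.
  apply: leq_ex_rings => E E3 noring; rewrite truncn_ge_nat; last first.
    by rewrite addr_ge0 // divr_ge0 // mulr_ge0 ?exprn_ge0 //; lra.
  by have := bound _ E E3 noring; rewrite card_ord.
apply: le_trans exle _; rewrite bin3_natr.
have : (1 <= n.+1%:R :> R)%R by rewrite ler1n.
rewrite -(natr1 n.+3) -(natr1 n.+2) -(natr1 n.+1).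
have K0 : (0 <= K%:R :> R)%R by [].
move: nlarge K0; move: (n.+1%:R)%R (K%:R)%R => u c ularge c0 u1.
(* With u = n + 1 and c = K, the inequality to prove is
   6 c + (1/2 + eps) (u + 3)^3 <= (1/2 + 2 eps) (u + 2) (u + 1) u;
   the cubic terms differ by eps u^3, which the choice of N makes larger than
   everything else. *)
have uu : (u <= u ^+ 2)%R by nra.
have eu : ((6 * c + 50) * u ^+ 2 <= eps * u * u ^+ 2)%R.
  by rewrite ler_wpM2r // exprn_ge0 //; lra.
have cu : (0 <= c * (u ^+ 2 - 1))%R by rewrite mulr_ge0 //; lra.
have epsu : (0 <= eps * (3 * u ^+ 2 + 2 * u))%R.
  by rewrite mulr_ge0 ?ltW //; lra.
have epsu' : (0 <= (1 / 4 - eps) * (9 * u ^+ 2 + 27 * u + 27))%R.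
  by rewrite mulr_ge0 //; lra.
by lra.
Qed.

Theorem theorem4p4 (R : realType) : turan_density R rings = (1 / 2 : R)%R.
Proof.
apply/cvg_lim => //; apply/cvgrPdist_le => /= delta delta0.
pose eps := Num.min (1 / 4)%R (delta / 2)%R : R.
have eps01 : (0 < eps <= 1 / 4)%R.
  by rewrite lt_min ge_min lexx !divr_gt0.
have [N upper] := ex_rings_density_le eps01.
exists (maxn N 3) => // n /=; rewrite geq_max => /andP[/upper ub n3].
have binpos : (0 < 'C(n, 3)%:R :> R)%R by rewrite ltr0n bin_gt0.
have lower : (1 / 2 <= (ex n rings)%:R / 'C(n, 3)%:R :> R)%R.
  rewrite ler_pdivlMr //.
  have := leq_bin3_double_parity_edges n; rewrite -(ler_nat R) natrM.
  have := ex_rings_ge (@parity_edges_uniform3 n) (@parity_edges_no_ring n).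
  by rewrite -(ler_nat R); lra.
have epsle : (eps <= delta / 2)%R by rewrite ge_min lexx orbT.
by rewrite ler_norml; apply/andP; lra.
Qed.
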